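(* Let $G$ be a finite simple $r$-regular graph with $n$ vertices, where $r\ge 1$. Then $\chi_2(G)-\chi(G)\le 2\lceil \frac{n}{r}\rceil-2$.
   Context: $\chi(G)$ is the chromatic number of $G$. A dynamic coloring of $G$ is a proper vertex coloring such that for every vertex $v$ of degree at least $2$, the neighbours of $v$ receive at least two different colors; $\chi_2(G)$ is the smallest number of colors in a dynamic coloring of $G$. *)

(* Defs.v *)
From mathcomp Require Import all_boot all_order all_algebra.

Set Implicit Arguments.
Unset Strict Implicit.
Unset Printing Implicit Defensive.

Record sgraph := SGraph {
  vertex :> finType;
  adj : rel vertex;
  adj_sym : symmetric adj;
  adj_irr : irreflexive adj }.

Definition neighbours (G : sgraph) (v : G) : {set G} := [set w | adj v w].

Definition degree (G : sgraph) (v : G) : nat := #|neighbours v|.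

Definition regular (G : sgraph) (r : nat) : Prop :=
  forall v : G, degree v = r.

Definition proper_coloring (G : sgraph) (k : nat) (c : {ffun G -> 'I_k}) : bool :=
  [forall v, forall w, adj v w ==> (c v != c w)].

Definition dynamic_coloring (G : sgraph) (k : nat) (c : {ffun G -> 'I_k}) : bool :=
  proper_coloring c &&
  [forall v, (2 <= degree v) ==> (2 <= #|c @: neighbours v|)].

(* Colorings need not be surjective: [k] bounds the number of colors used. *)
Definition colorable (G : sgraph) (k : nat) : bool :=
  [exists c : {ffun G -> 'I_k}, proper_coloring c].

Definition dynamic_colorable (G : sgraph) (k : nat) : bool :=
  [exists c : {ffun G -> 'I_k}, dynamic_coloring c].

Lemma dynamic_colorable_ex (G : sgraph) : exists k, dynamic_colorable G k.
Proof.
exists #|G|; apply/existsP; exists [ffun v => enum_rank v].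
apply/andP; split; apply/forallP => v.
  apply/forallP => w; apply/implyP; apply: contraTneq.
  by rewrite !ffunE => /enum_rank_inj ->; rewrite adj_irr.
apply/implyP; rewrite card_imset // => x y.
by rewrite !ffunE => /enum_rank_inj.
Qed.

Lemma colorable_ex (G : sgraph) : exists k, colorable G k.
Proof.
have [k /existsP[c /andP[pc _]]] := dynamic_colorable_ex G.
by exists k; apply/existsP; exists c.
Qed.

Definition chromatic_number (G : sgraph) : nat := ex_minn (colorable_ex G).

Definition dynamic_chromatic_number (G : sgraph) : nat :=
  ex_minn (dynamic_colorable_ex G).

(* Main.v *)
Require Import Defs.
From mathcomp Require Import all_boot all_order all_algebra.
From mathcomp Require Import zify.
Import Order.TTheory GRing.Theory Num.Theory.
Local Open Scope ring_scope.

Set Implicit Arguments.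
Unset Strict Implicit.
Unset Printing Implicit Defensive.

(** Fix an optimal proper coloring and call a vertex of degree at least 2 bad
    if its neighbourhood is monochromatic. Take a maximal set S of bad vertices
    with pairwise disjoint neighbourhoods, so that r|S| <= n, and for each v in S
    recolor the neighbourhood of v with two colors of its own, both used. The
    result refines the original coloring, so it is proper and only bad vertices
    could fail. The neighbourhood of a bad vertex u meets N(v) for some v in S by
    maximality; if it were still monochromatic it would lie inside N(v), hence
    equal N(v) by regularity, but N(v) carries two colors.
    If r|S| < n then |S| <= ceil(n/r) - 1 and chi + 2|S| colors suffice. If
    r|S| = n then the sets N(v) cover G, all original colors disappear, and
    2|S| = 2 ceil(n/r) colors suffice, while chi >= 2. *)

(** Allows colors from any finite type and charges only for those that occur, by numbering the image
    of [f]. *)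
Lemma dynamic_chromatic_number_le (G : sgraph) (C : finType) (f : G -> C) :
  (forall v w, adj v w -> f v != f w) ->
  (forall v, 2 <= degree v -> 2 <= #|f @: neighbours v|)%N ->
  (dynamic_chromatic_number G <= #|f @: [set: G]|)%N.
Proof.
move=> fP fD; set A := f @: _.
have fA v : f v \in A by rewrite imset_f.
rewrite /dynamic_chromatic_number; case: ex_minnP => m _; apply.
apply/existsP; exists [ffun v => enum_rank_in (fA v) (f v)].
have rank_eq v w : enum_rank_in (fA v) (f v) = enum_rank_in (fA w) (f w) ->
    f v = f w.
  by move/(congr1 enum_val); rewrite !enum_rankK_in.
apply/andP; split; apply/forallP => v.
  apply/forallP => w; apply/implyP => /fP; apply: contraNneq.
  by rewrite !ffunE => /rank_eq ->.
apply/implyP => /fD; rewrite -[X in (_ <= X -> _)%N](@card_in_imset _ _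
  (enum_rank_in (fA v))); last first.
  move=> _ _ /imsetP[x _ ->] /imsetP[y _ ->] /(congr1 enum_val).
  by rewrite !enum_rankK_in.
rewrite -imset_comp; congr (_ <= _)%N; congr #|pred_of_set _|.
(* Ranks taken with different default elements agree, since both decode to [f x]. *)
apply: eq_imset => x /=; rewrite ffunE; apply: enum_val_inj.
by rewrite !enum_rankK_in.
Qed.

Lemma card_imset_le1_eq (T C : finType) (f : T -> C) (A : {set T}) :
  (#|f @: A| <= 1)%N -> {in A &, forall x y, f x = f y}.
Proof. by move=> /card_le1_eqP fA x y xA yA; apply: fA; apply: imset_f. Qed.

Definition bad (G : sgraph) (k : nat) (c : {ffun G -> 'I_k}) : {set G} :=
  [set v | (2 <= degree v)%N && (#|c @: neighbours v| <= 1)%N].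

Definition nbhd_packing (G : sgraph) (S : {set G}) : bool :=
  [forall u in S, forall v in S,
    (u != v) ==> [disjoint neighbours u & neighbours v]].

Lemma nbhd_packing_inj (G : sgraph) (S : {set G}) (u v x : G) :
  nbhd_packing S -> u \in S -> v \in S -> adj u x -> adj v x -> u = v.
Proof.
move=> /forall_inP packS uS vS ux vx; apply/eqP; apply: contraT => neq_uv.
have /implyP/(_ neq_uv) := forall_inP (packS u uS) v vS.
by rewrite disjoints_subset => /subsetP/(_ x); rewrite !inE ux vx => /(_ isT).
Qed.

Lemma card_nbhd_packing (G : sgraph) (r : nat) (S : {set G}) :
  regular G r -> nbhd_packing S -> #|\bigcup_(v in S) neighbours v| = (#|S| * r)%N.
Proof.
move=> reg packS; rewrite big_mkcond -sum1_card partition_disjoint_bigcup /=.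
  rewrite -sum_nat_const [RHS]big_mkcond /=; apply: eq_bigr => v _.
  by rewrite sum1_card; case: ifP => _; [apply: reg | apply: cards0].
move=> u v neq_uv; have [uS|_] := boolP (u \in S); last by rewrite disjoints_subset sub0set.
have [vS|_] := boolP (v \in S); last first.
  by rewrite disjoint_sym disjoints_subset sub0set.
exact: implyP (forall_inP (forall_inP packS u uS) v vS) neq_uv.
Qed.

Lemma maximal_bad_packing (G : sgraph) (k : nat) (c : {ffun G -> 'I_k}) :
  exists S : {set G}, [/\ S \subset bad c, nbhd_packing S &
    forall v, v \in bad c -> exists u x, [/\ u \in S, adj u x & adj v x]].
Proof.
pose P (S : {set G}) := (S \subset bad c) && nbhd_packing S.
have P0 : P set0 by rewrite /P sub0set; apply/forall_inP => u; rewrite inE.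
have [S /maxsetP[/andP[Sbad packS] maxS] _] := maxset_exists P0.
exists S; split=> // v vbad; have [vS | vS] := boolP (v \in S).
  have : (0 < degree v)%N by move: vbad; rewrite inE => /andP[/ltnW].
  by case/card_gt0P => x; rewrite inE => vx; exists v, x.
have [/exists_inP[u uS /existsP[x /andP[ux vx]]] | none] :=
    boolP [exists u in S, exists x, adj u x && adj v x]; first by exists u, x.
have disj u : u \in S -> [disjoint neighbours u & neighbours v].
  move=> uS; rewrite disjoints_subset; apply/subsetP => x; rewrite !inE => ux.
  apply: contra none => vx.
  by apply/exists_inP; exists u => //; apply/existsP; exists x; rewrite ux.
(* Otherwise [v |: S] is a larger packing of bad vertices, against maximality. *)
case/negP: vS; rewrite -(maxS (v |: S)) ?setU11 ?subsetUr //.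
rewrite /P subUset sub1set vbad Sbad; apply/forall_inP => u uvS.
apply/forall_inP => w wvS; apply/implyP.
case/setU1P: uvS => [->|uS]; case/setU1P: wvS => [->|wS]; rewrite ?eqxx //.
- by rewrite disjoint_sym disj.
- by rewrite disj.
- exact/implyP/(forall_inP (forall_inP packS u uS) w wS).
Qed.

(** The neighbour that gets the second private color of [v]; the default is reached only when [v] is
    isolated. *)
Definition marked (G : sgraph) (v : G) : G :=
  odflt v [pick x in neighbours v].

(** The left summand holds the old colors, the right one two private colors for each vertex. The
    choice of [v] is unambiguous when [S] is a packing. *)
Definition recolor (G : sgraph) (k : nat) (c : {ffun G -> 'I_k}) (S : {set G})
    (x : G) : 'I_k + G * bool :=
  if [pick v in S | adj v x] is Some v then inr (v, x == marked v) else inl (c x).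

Lemma recolor_in (G : sgraph) (k : nat) (c : {ffun G -> 'I_k}) (S : {set G})
    (v x : G) :
  nbhd_packing S -> v \in S -> adj v x -> recolor c S x = inr (v, x == marked v).
Proof.
move=> packS vS vx; rewrite /recolor; case: pickP => [u /andP[uS ux] | /(_ v)].
  by rewrite (nbhd_packing_inj packS uS vS ux vx).
by rewrite vS vx.
Qed.

Lemma recolor_inr (G : sgraph) (k : nat) (c : {ffun G -> 'I_k}) (S : {set G})
    (v x : G) (b : bool) :
  recolor c S x = inr (v, b) -> v \in S /\ adj v x.
Proof. by rewrite /recolor; case: pickP => // u /andP[uS ux] [<- _]. Qed.

(** A private color of [v] occurs only on the neighbourhood of [v], where [c] is constant because
    [v] is bad. *)
Lemma recolor_refines (G : sgraph) (k : nat) (c : {ffun G -> 'I_k}) (S : {set G})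
    (x y : G) :
  S \subset bad c -> recolor c S x = recolor c S y -> c x = c y.
Proof.
move=> /subsetP Sbad; case fx: (recolor c S x) => [i | [v b]] => /esym fy.
  by move: fx fy; rewrite /recolor; do 2![case: pickP => // _] => -[<-] [].
have [vS vx] := recolor_inr fx; have [_ vy] := recolor_inr fy.
have := Sbad v vS; rewrite inE => /andP[_ /card_imset_le1_eq].
by apply; rewrite inE.
Qed.

Lemma recolor_dynamic (G : sgraph) (r k : nat) (c : {ffun G -> 'I_k})
    (S : {set G}) (v : G) :
  regular G r -> S \subset bad c -> nbhd_packing S ->
  (forall w, w \in bad c -> exists u x, [/\ u \in S, adj u x & adj w x]) ->
  (2 <= degree v)%N -> (2 <= #|recolor c S @: neighbours v|)%N.
Proof.
move=> reg Sbad packS maxS deg_v; rewrite ltnNge; apply/negP.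
move=> /card_imset_le1_eq constN.
(* By refinement [v] was already monochromatic under [c], hence bad. *)
have [|u [x [uS ux vx]]] := maxS v.
  rewrite inE deg_v; apply/card_le1_eqP => _ _ /imsetP[y yN ->] /imsetP[z zN ->].
  exact: recolor_refines Sbad (constN _ _ _ _).
have fx := recolor_in c packS uS ux.
have fN y : adj v y -> recolor c S y = inr (u, x == marked u).
  by move=> vy; rewrite -fx; apply: constN; rewrite inE.
have eqN : neighbours v = neighbours u.
  apply/eqP; rewrite eqEcard -!/(degree _) !reg leqnn andbT.
  by apply/subsetP => y; rewrite !inE => /fN/recolor_inr[].
(* The mark is constant on the neighbourhood of [u] and holds at [marked u], so that neighbourhood
   is a single vertex, against degree at least 2. *)
have same y : adj u y -> (y == marked u) = (x == marked u).
  move=> uy; have vy : adj v y by have /setP/(_ y) := eqN; rewrite !inE uy.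
  by have := fN y vy; rewrite (recolor_in c packS uS uy) => -[].
have um : adj u (marked u).
  rewrite /marked; case: pickP => [y | /(_ x)] /=; first by rewrite inE.
  by rewrite inE ux.
have : (degree u <= 1)%N.
  have allm y : adj u y -> y = marked u.
    by move=> uy; apply/eqP; rewrite same // -(same _ um).
  by apply/card_le1_eqP => y z; rewrite !inE => /allm -> /allm ->.
by rewrite reg -(reg v) leqNgt deg_v.
Qed.

Lemma dynamic_chromatic_number_packing (G : sgraph) (r k : nat) :
  regular G r -> colorable G k ->
  exists s, (s * r < #|G|)%N /\ (dynamic_chromatic_number G <= k + s * 2)%N
    \/ (s * r)%N = #|G| /\ (dynamic_chromatic_number G <= s * 2)%N.
Proof.
move=> reg /existsP[c /forallP c_proper].
have [S [Sbad packS maxS]] := maximal_bad_packing c.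
have chi2_le : (dynamic_chromatic_number G <= #|recolor c S @: [set: G]|)%N.
  apply: dynamic_chromatic_number_le => [v w vw | v].
    have /implyP/(_ vw) := forallP (c_proper v) w.
    by apply: contraNneq => /(recolor_refines Sbad) ->.
  exact: recolor_dynamic reg Sbad packS maxS.
have cardN := card_nbhd_packing reg packS.
have card_new : #|inr @: setX S [set: bool] : {set 'I_k + G * bool}| = (#|S| * 2)%N.
  by rewrite card_imset ?cardsX ?cardsT ?card_bool // => ? ? [].
exists #|S|; have : (#|S| * r <= #|G|)%N by rewrite -cardN max_card.
rewrite leq_eqVlt => /predU1P[eqn | ltn]; [right | left]; split=> //;
  apply: leq_trans chi2_le _.
  (* The neighbourhoods cover [G], so only private colors occur. *)
  rewrite -card_new; apply/subset_leq_card/subsetP => _ /imsetP[x _ ->].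
  have : x \in \bigcup_(v in S) neighbours v.
    have /eqP -> : \bigcup_(v in S) neighbours v == [set: G].
      by rewrite eqEcard subsetT cardsT cardN eqn leqnn.
    by rewrite inE.
  case/bigcupP => v vS; rewrite inE => /(recolor_in c packS vS) ->.
  by rewrite imset_f // !inE vS.
have card_old : #|inl @: [set: 'I_k] : {set 'I_k + G * bool}| = k.
  by rewrite card_imset ?cardsT ?card_ord // => ? ? [].
rewrite -card_new -[X in (_ <= X + _)%N]card_old.
apply: leq_trans (leq_card_setU _ _); apply/subset_leq_card/subsetP => y.
case/imsetP => x _ ->; rewrite inE.
case fx: (recolor c S x) => [i | [v b]]; first by rewrite imset_f ?inE.
have [vS _] := recolor_inr fx.
by apply/orP; right; rewrite imset_f // !inE vS.
Qed.

Lemma colorable_edge_ge2 (G : sgraph) (k : nat) (v w : G) :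
  colorable G k -> adj v w -> (2 <= k)%N.
Proof.
case/existsP => c /forallP/(_ v)/forallP/(_ w)/implyP neq_c /neq_c.
case: k c {neq_c} => [|[|k]] c //.
  by case: (c v).
by rewrite !ord1.
Qed.

Theorem theorem7 (G : sgraph) (n r : nat) (hr : (1 <= r)%N)
    (hn : #|G| = n) (hn0 : (0 < n)%N) (hreg : regular G r) :
  (dynamic_chromatic_number G)%:Z - (chromatic_number G)%:Z
    <= 2 * Num.ceil (n%:R / r%:R : rat) - 2.
Proof.
set t := Num.ceil _.
have n_le : n%:Z <= t * r%:Z.
  rewrite -(ler_int rat) intrM -ler_pdivrMr ?ltr0n //.
  by rewrite -!pmulrn; apply: Num.Theory.ceil_ge.
have k_col : colorable G (chromatic_number G).
  by rewrite /chromatic_number; case: ex_minnP.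
set k := chromatic_number G in k_col *.
have k_ge2 : (2 <= k)%N.
  have /card_gt0P[v _] : (0 < #|G|)%N by rewrite hn.
  have : (0 < degree v)%N by rewrite hreg.
  by case/card_gt0P => w; rewrite inE; apply: colorable_edge_ge2.
have [s] := dynamic_chromatic_number_packing hreg k_col; rewrite hn.
case=> -[s_n chi2].
  (* Integrality turns [s < t] into [s <= t - 1], which yields the term [-2]. *)
  have : s%:Z < t by rewrite -(ltr_pM2r (_ : 0 < r%:Z)) //; lia.
  by lia.
(* Only [s <= t] is available here; the missing 2 comes from [k_ge2]. *)
have : s%:Z <= t by rewrite -(ler_pM2r (_ : 0 < r%:Z)) //; lia.
by lia.
Qed.
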